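(* Let $H\subsetneq\mathbb{N}$ be an Arf numerical semigroup written as $$H=\{h_0=0,h_1,\dots,h_n,\rightarrow\}=\{0,x_1,x_1+x_2,\dots,x_1+\dots+x_n,\rightarrow\}$$ with positive integers $x_1,\dots,x_n$ and $h_j=x_1+\dots+x_j$ for all $j\in\{1,\dots,n\}$. Let $i\in\{1,\dots,n\}$, so that $h_i\in H$ is a nonzero element with $h_i\le \mathrm{F}(H)+1$. Then $h_i$ is in the minimal Arf system of generators of $H$ if and only if $x_j\ne x_{j+1}+\dots+x_i$ for all $j$ with $1\le j<i$.
   Context: $\mathbb{N}$ is the set of non-negative integers. A numerical semigroup is a subset $H\subseteq\mathbb{N}$ that contains $0$, is closed under addition, and has finite complement in $\mathbb{N}$. It is Arf if $2a-b\in H$ for all $a,b\in H$ with $a\ge b$. The Frobenius number $\mathrm{F}(H)$ is the largest element of $\mathbb{N}\setminus H$. The notation $H=\{h_0=0,h_1,\dots,h_n,\rightarrow\}$ means that $h_0<h_1<\dots<h_n$ are the elements of $H$ up to its conductor $h_n=\mathrm{F}(H)+1$, listed increasingly, and that every integer larger than $h_n$ is in $H$; thus $x_j=h_j-h_{j-1}$. (It is known that a set of this form, with $x_j$ positive integers, is an Arf numerical semigroup if and only if $x_j\in\{x_{j+1},x_{j+1}+x_{j+2},\dots,x_{j+1}+\dots+x_n,\rightarrow\}$ for all $j\in\{1,\dots,n\}$, where ''$\rightarrow$'' means that all larger integers are included.) For $X\subset\mathbb{N}$ with $\gcd(X)=1$, $\langle X\rangle$ is the submonoid of $\mathbb{N}$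 generated by $X$ and $\mathrm{Arf}(\langle X\rangle)$ (the Arf closure) is the smallest Arf numerical semigroup, with respect to inclusion, containing $\langle X\rangle$. $X$ is an Arf system of generators of $H$ if $\mathrm{Arf}(\langle X\rangle)=H$, and it is minimal if no proper subset of $X$ is an Arf system of generators of $H$. It is known that every Arf numerical semigroup has a unique minimal Arf system of generators. *)

(* Defs.v *)
From mathcomp Require Import all_boot.
From mathcomp Require Import boolp classical_sets functions cardinality.

Set Implicit Arguments.
Unset Strict Implicit.
Unset Printing Implicit Defensive.

Local Open Scope classical_set_scope.
Local Open Scope nat_scope.

Definition submonoid (A : set nat) : Prop :=
  A 0 /\ forall a b, A a -> A b -> A (a + b).

Definition numerical_semigroup (H : set nat) : Prop :=
  submonoid H /\ finite_set (~` H).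

(* The subtraction is never truncated, because b <= a. *)
Definition arf_numerical_semigroup (H : set nat) : Prop :=
  numerical_semigroup H /\
  forall a b, H a -> H b -> b <= a -> H (2 * a - b).

(* A relation, because the Frobenius number of setT does not exist in nat. *)
Definition is_frobenius_number (H : set nat) (f : nat) : Prop :=
  ~ H f /\ forall m, ~ H m -> m <= f.

(* H = {h 0 = 0, h 1, ..., h n, ->} with h n = F(H) + 1. *)
Definition listed_to_conductor (H : set nat) (n : nat) (h : nat -> nat) : Prop :=
  [/\ h 0 = 0,
      (forall j, j < n -> h j < h j.+1),
      (exists2 f, is_frobenius_number H f & h n = f.+1) &
      H = [set h j | j in [set j | j <= n]] `|` [set m | h n < m]].

(* For the divisibility order, so that the gcd of an infinite set makes sense
   and the gcd of the empty set and of [set 0] is 0. *)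
Definition is_gcd (X : set nat) (g : nat) : Prop :=
  forall d, d %| g <-> (forall x, X x -> d %| x).

Definition generated_submonoid (X : set nat) : set nat := smallest submonoid X.

(* [smallest] is the intersection of all Arf numerical semigroups containing
   the given set.  When X has gcd 1 this intersection is itself an Arf
   numerical semigroup, since its complement lies in the finite complement of
   generated_submonoid X; Arf closures are only used for such X below. *)
Definition arf_closure (X : set nat) : set nat :=
  smallest arf_numerical_semigroup (generated_submonoid X).

Definition arf_system_of_generators (X H : set nat) : Prop :=
  is_gcd X 1 /\ arf_closure X = H.

Definition minimal_arf_system_of_generators (X H : set nat) : Prop :=
  arf_system_of_generators X H /\
  forall Y, Y `<` X -> ~ arf_system_of_generators Y H.

(* Main.v *)
(** Put [a = h i].  Since [x j = h j - h (j-1)], the condition says that [a] is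
    never [2 * h j - h (j-1)] with [1 <= j < i].

    If the condition holds, [H] minus [a] is again an Arf numerical semigroup:
    by descending induction it is enough to check the Arf property on pairs of
    consecutive elements, and the only pairs for which [a] could be hit lie
    below [a], hence are consecutive in [H].  A system of generators avoiding
    [a] would generate a subset of [H] minus [a], so [X] contains [a].

    Conversely, suppose [a = 2 * h j - h (j-1)], and let [A] be any Arf
    submonoid of nat containing [X] minus [a].  The elements of [H] that are at
    least [a] or in [A] form an Arf numerical semigroup containing [X], hence
    all of [H]; so [A] contains every element of [H] below [a], and thus [a].
    Taking for [A] the Arf numerical semigroups and the sets [d * nat] shows
    that [X] minus [a] still generates [H] and has gcd [1]. *)

Require Import Defs.
From mathcomp Require Import all_boot zify.
From mathcomp Require Import boolp classical_sets functions cardinality.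

Local Open Scope classical_set_scope.
Local Open Scope nat_scope.

Lemma arf_system_sub (X H : set nat) :
  arf_system_of_generators X H -> X `<=` H.
Proof.
by move=> [_ <-] y Xy; apply: sub_gen_smallest; exact: sub_gen_smallest.
Qed.

Lemma arf_closure_min (X S : set nat) :
  arf_numerical_semigroup S -> X `<=` S -> arf_closure X `<=` S.
Proof.
move=> S_arf XS; apply: smallest_sub => //.
by apply: smallest_sub => //; case: S_arf => -[].
Qed.

(** Descending induction on [v]. If [s] is the successor of [v] in [G], then [u + w - v = (u + w -
    s) + (2 * s - v) - s], where both bracketed terms lie in [G] and are at least [s]. The
    three-term form covers sums ([v = 0]) and the Arf property ([u = w]) at once. *)
Lemma arf_of_consecutive (G : set nat) (c : nat) :
  (forall m, c <= m -> G m) ->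
  (forall p u, G p -> G u -> p < u ->
     (forall m, G m -> p < m -> u <= m) -> G (2 * u - p)) ->
  forall v u w, G v -> G u -> G w -> v <= u -> v <= w -> G (u + w - v).
Proof.
move=> Gc Gcons v; have [k] := ubnP (c - v); elim: k v => // k IH v vk.
move=> u w Gv Gu Gw vu vw.
have [cv|vc] := leqP c v; first by apply: Gc; lia.
have [<-|uv] := eqVneq v u; first by rewrite addKn.
have [<-|wv] := eqVneq v w; first by rewrite addnK.
have exP : exists m, `[< G m >] && (v < m).
  by exists u; apply/andP; split; [apply/asboolP|lia].
have [s /andP[/asboolP Gs vs] s_min] := ex_minnP exP.
have succ_s m : G m -> v < m -> s <= m.
  by move=> Gm vm; apply: s_min; apply/andP; split => //; apply/asboolP.
have su : s <= u by apply: succ_s => //; lia.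
have sw : s <= w by apply: succ_s => //; lia.
have Gs2 := Gcons v s Gv Gs vs succ_s.
have Guws : G (u + w - s) by apply: IH => //; lia.
have -> : u + w - v = (u + w - s) + (2 * s - v) - s by lia.
by apply: IH => //; lia.
Qed.

Lemma arf_remove (H : set nat) (a c : nat) :
  arf_numerical_semigroup H -> 0 < a -> (forall m, c <= m -> H m) ->
  (forall p u, H p -> H u -> p < u -> u < a ->
     (forall m, H m -> p < m -> u <= m) -> 2 * u - p <> a) ->
  arf_numerical_semigroup (H `\ a).
Proof.
move=> [[[H0 _] Hfin] Harf] a_gt0 Hc Ha.
have Gadd : forall v u w, (H `\ a) v -> (H `\ a) u -> (H `\ a) w ->
    v <= u -> v <= w -> (H `\ a) (u + w - v).
  apply: (@arf_of_consecutive _ (c + a).+1) => [m cm|p u [Hp pa] [Hu ua] pu us].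
    by split => /=; [apply: Hc; lia|lia].
  split; first by apply: Harf => //; exact: ltnW.
  (* Since [p < u], the equation [e] forces [u < a]; so restoring [a] leaves [u] the successor of
     [p], now in [H]. *)
  move=> /= e; have {}ua : u <> a by [].
  apply: (Ha p u) => //; first by lia.
  move=> m Hm pm; have [ma|/eqP ma] := eqVneq m a; first by lia.
  exact: us.
have G0 : (H `\ a) 0 by split => //=; lia.
split; last first.
  by move=> u v Gu Gv vu; rewrite mul2n -addnn; exact: Gadd.
split; first by split => // u v Gu Gv; rewrite -[u + v]subn0; exact: Gadd.
apply: (@sub_finite_set _ _ (~` H `|` [set a])); last first.
  by rewrite finite_setU; split.
move=> m /= mG; have [ma|ma] := pselect (m = a); first by right.
by left => Hm; apply: mG.
Qed.

(** Both [u + v] and, for [v <= u], [2 * u - v] are at least [u] and [v], so a result below [a] only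
    involves elements below [a], which lie in [A]. *)
Lemma arf_truncate (H A : set nat) (a : nat) :
  arf_numerical_semigroup H -> submonoid A ->
  (forall u v, A u -> A v -> v <= u -> A (2 * u - v)) ->
  arf_numerical_semigroup [set m | H m /\ (m < a -> A m)].
Proof.
move=> [[[H0 Hadd] Hfin] Harf] [A0 Aadd] Aarf; split; last first.
  move=> u v [Hu Au] [Hv Av] vu; split=> [|lta]; first exact: Harf.
  by apply: Aarf => //; [apply: Au|apply: Av]; lia.
split.
  split=> [|u v [Hu Au] [Hv Av]]; first by [].
  split=> [|lta]; first exact: Hadd.
  by apply: Aadd; [apply: Au|apply: Av]; lia.
apply: (@sub_finite_set _ _ (~` H `|` `I_a)); last first.
  by rewrite finite_setU; split => //; exact: finite_II.
move=> m /= mS; have [Hm|] := pselect (H m); last by left.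
by right; case: ltnP => // am; case: mS; split=> //; rewrite ltnNge am.
Qed.

Lemma arf_generator_redundant (X H A : set nat) (a u v : nat) :
  arf_numerical_semigroup H -> arf_system_of_generators X H ->
  H u -> H v -> v < u -> 2 * u - v = a ->
  submonoid A -> (forall s t, A s -> A t -> t <= s -> A (2 * s - t)) ->
  X `\ a `<=` A -> X `<=` A.
Proof.
move=> H_arf X_gen Hu Hv vu a_uv A_mon A_arf XA.
have HA m : H m -> m < a -> A m.
  move=> Hm ma; case: X_gen (arf_system_sub _ _ X_gen) => _ clX XH.
  have : arf_closure X `<=` [set m | H m /\ (m < a -> A m)].
    apply: arf_closure_min; first exact: arf_truncate.
    by move=> y Xy; split=> [|ya]; [exact: XH|apply: XA; split => //=; lia].
  by rewrite clX => /(_ m Hm) [_]; exact.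
move=> y Xy; have [->|ya] := pselect (y = a); last by apply: XA.
(* From [v < u] follows [u < 2 * u - v = a], so [HA] applies to [u] and [v]. *)
by rewrite -a_uv; apply: A_arf; [apply: HA|apply: HA|]; lia || assumption.
Qed.

Lemma minimal_arf_generator_not_doubling (X H : set nat) (a u v : nat) :
  arf_numerical_semigroup H -> minimal_arf_system_of_generators X H ->
  H u -> H v -> v < u -> X a -> 2 * u - v <> a.
Proof.
move=> H_arf [X_gen X_min] Hu Hv vu Xa a_uv.
have XA A := @arf_generator_redundant X H A a u v H_arf X_gen Hu Hv vu a_uv.
apply: (X_min (X `\ a)).
  by split; [exact: subDsetl|move=> /(_ a Xa) [_]; exact].
case: X_gen => X_gcd clX; split.
  move=> d; split=> [d1 x [Xx _]|dY]; first by move/X_gcd: d1; exact.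
  apply/X_gcd; apply: (XA [set m | d %| m]) => //=.
    by split=> [|s t ds dt] /=; [exact: dvdn0|exact: dvdn_add].
  by move=> s t ds dt _; apply: dvdn_sub => //; exact: dvdn_mull.
rewrite -[RHS]clX; apply/seteqP; split.
  apply: smallest_sub; first by rewrite clX.
  apply: smallest_sub; first by rewrite clX; case: H_arf => -[].
  by rewrite clX => y [Xy _]; apply: (arf_system_sub X) => //; split.
move=> m clm S [S_arf YS]; apply: (arf_closure_min _ _ S_arf _ _ clm).
case: (S_arf) => -[S_mon _] S2; apply: XA => //.
by apply: subset_trans YS; exact: sub_gen_smallest.
Qed.

Lemma listed_increasing (H : set nat) (n : nat) (h : nat -> nat) :
  listed_to_conductor H n h -> forall j k, j < k <= n -> h j < h k.
Proof.
move=> [_ h_step _ _] j k; elim: k => // k IH /andP[jk kn].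
have := h_step k kn; have [<- //|jk'] := eqVneq j k.
by apply: ltn_trans; apply: IH; lia.
Qed.

Theorem theorem4p3 (H : set nat) (n : nat) (h x : nat -> nat)
  (H_arf : arf_numerical_semigroup H)
  (H_proper : H `<` [set: nat])
  (H_list : listed_to_conductor H n h)
  (x_gt0 : forall j, 1 <= j <= n -> 0 < x j)
  (h_sum : forall j, 1 <= j <= n -> h j = \sum_(1 <= k < j.+1) x k)
  (i : nat) (i_range : 1 <= i <= n)
  (X : set nat) (X_min : minimal_arf_system_of_generators X H) :
  X (h i) <->
  (forall j, 1 <= j < i -> x j <> \sum_(j.+1 <= k < i.+1) x k).
Proof.
have h_lt := listed_increasing _ _ _ H_list.
case: (H_list) => h0 _ _ HE.
(* The case [j = 0], an empty sum, serves [h j.-1] when [j = 1]. *)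
have h_sum0 j : j <= n -> h j = \sum_(1 <= k < j.+1) x k.
  by case: j => [_|j jn]; [rewrite h0 big_geq|exact: h_sum].
have Hh j : j <= n -> H (h j) by move=> jn; rewrite HE; left; exists j.
have condE j : 1 <= j < i ->
    x j = \sum_(j.+1 <= k < i.+1) x k <-> 2 * h j - h j.-1 = h i.
  case: j => // j ji.
  have := h_sum0 i; rewrite (@big_cat_nat _ _ _ j.+2) //=; last by lia.
  rewrite -h_sum0; last by lia.
  have := h_sum0 j.+1; rewrite big_nat_recr //= -h_sum0; last by lia.
  by move=> /(_ ltac:(lia)) hj /(_ ltac:(lia)) hi; lia.
have {condE} -> : (forall j, 1 <= j < i -> x j <> \sum_(j.+1 <= k < i.+1) x k)
    <-> (forall j, 1 <= j < i -> 2 * h j - h j.-1 <> h i).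
  by split=> cond j ji /(condE j ji); exact: cond.
split=> [Xa j ji|cond].
  apply: (minimal_arf_generator_not_doubling X H) => //; try by apply: Hh; lia.
  by apply: h_lt; lia.
have a_arf : arf_numerical_semigroup (H `\ h i).
  apply: (@arf_remove _ _ (h n).+1) => //.
  - by rewrite -h0; apply: h_lt; lia.
  - by move=> m nm; rewrite HE; right.
  have below m : H m -> m < h i -> exists2 j, j < i & h j = m.
    rewrite HE => -[[j /= jn <-]|/= hm] ma.
      by exists j => //; rewrite ltnNge; apply/negP => ij;
        have [e|ne] := eqVneq i j; [rewrite e in ma|have := h_lt i j]; lia.
    by have [e|ne] := eqVneq i n; [rewrite e in ma|have := h_lt i n]; lia.
  move=> p u Hp Hu pu ua us.
  have [j ji hj] := below u Hu ua.
  have [k ki hk] := below p Hp (ltn_trans pu ua).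
  have kj : k < j.
    rewrite ltnNge; apply/negP => jk.
    by have [e|ne] := eqVneq j k; [subst k|have := h_lt j k]; lia.
  (* Otherwise [k < j.-1], and [h j.-1] would lie strictly between the consecutive elements [p] and
     [u]. *)
  have <- : h j.-1 = p.
    have hjj : h j.-1 < h j by apply: h_lt; lia.
    have [->//|ne] := eqVneq j.-1 k.
    have pj : p < h j.-1 by rewrite -hk; apply: h_lt; lia.
    by have := us (h j.-1) (Hh j.-1 ltac:(lia)) pj; lia.
  by rewrite -hj; apply: cond; lia.
case: X_min => X_gen _; apply: contrapT => Xa.
have XH := arf_system_sub _ _ X_gen; case: X_gen => _ clX.
have : arf_closure X `<=` H `\ h i.
  apply: arf_closure_min => // y Xy; split; first exact: XH.
  by move=> /= e; apply: Xa; rewrite -e.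
by rewrite clX => /(_ (h i) (Hh i ltac:(lia))) [_]; exact.
Qed.
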